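(* Let $P \in \mathbb{R}^{n \times k}$ and $Q \in \mathbb{R}^{m \times k}$ both have full rank $k$, with $k < \min\{m,n\}$, let $y \in \mathbb{R}^m$ with $y \neq 0$, and let $\lambda \geq 0$, $\epsilon \geq 0$. Set $$c := (Q^T Q)^{-1/2} Q^T y \in \mathbb{R}^k, \qquad s := \sqrt{y^T y - c^T c} \in \mathbb{R}, \qquad R := P (Q^T Q)^{1/2} \in \mathbb{R}^{n \times k}$$ (where $c^T c \le y^T y$, so that $s$ is well defined and $s \ge 0$). Then $$\min_{w \in \mathbb{R}^n} \Big( \| (PQ^T)^T w - y \|_2 + \epsilon \| w \|_2 + \lambda \| w \|_1 \Big) \;=\; \min_{w \in \mathbb{R}^n} \left( \left\| \begin{bmatrix} c - R^T w \\ s \end{bmatrix} \right\|_2 + \epsilon \| w \|_2 + \lambda \| w \|_1 \right).$$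
   Context: Here $(Q^TQ)^{1/2}$ denotes the symmetric positive definite square root of the positive definite matrix $Q^TQ$, and $(Q^TQ)^{-1/2}$ its inverse. $\begin{bmatrix} c - R^T w \\ s \end{bmatrix}$ is the vector in $\mathbb{R}^{k+1}$ obtained by appending $s$ to $c - R^T w$. $\|\cdot\|_2$ and $\|\cdot\|_1$ are the Euclidean and $\ell_1$ norms. *)

(* Defs.v *)
From mathcomp Require Import all_boot all_order all_algebra.
From mathcomp Require Import boolp classical_sets reals.

Set Implicit Arguments.
Unset Strict Implicit.
Unset Printing Implicit Defensive.

Import Order.TTheory GRing.Theory Num.Theory.

Local Open Scope classical_set_scope.
Local Open Scope ring_scope.

(* The norm `|v| that MathComp-Analysis puts on matrices is the max norm,
   hence the explicit Euclidean and l1 norms on column vectors. *)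
Definition norm2 (K : realType) (d : nat) (v : 'cV[K]_d) : K :=
  Num.sqrt (\sum_(i < d) v i 0 ^+ 2).

Definition norm1 (K : realType) (d : nat) (v : 'cV[K]_d) : K :=
  \sum_(i < d) `|v i 0|.

Definition dotcV (K : realType) (d : nat) (u v : 'cV[K]_d) : K :=
  (u^T *m v) 0 0.

Definition posdefmx (K : realType) (k : nat) (A : 'M[K]_k) : Prop :=
  A \is symmetricmx /\ forall x : 'cV[K]_k, x != 0 -> 0 < dotcV x (A *m x).

(* For symmetric positive definite A, a symmetric positive definite S with
   S *m S = A exists and is unique, so the choice below is no choice at all;
   the default value 0 only occurs for other A. *)
Definition sqrtmx (K : realType) (k : nat) (A : 'M[K]_k) : 'M[K]_k :=
  xget 0 [set S : 'M[K]_k | posdefmx S /\ S *m S = A].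

(* v = min f: the value v is attained by f and bounds f from below; there is
   at most one such v. *)
Definition is_min (K : realType) (T : Type) (f : T -> K) (v : K) : Prop :=
  (exists w : T, f w = v) /\ (forall w : T, v <= f w).

(* Main.v *)
Require Import Defs.
From mathcomp Require Import all_boot all_order all_algebra.
From mathcomp Require Import boolp classical_sets reals.
From mathcomp Require Import complex topology normedtype derive realfun.
From mathcomp Require Import ring.
Import numFieldNormedType.Exports.

Set Implicit Arguments.
Unset Strict Implicit.
Unset Printing Implicit Defensive.

Import Order.TTheory GRing.Theory Num.Theory.
Local Open Scope ring_scope.

(** With [S] the square root of [Q^T Q] and [z = P^T w], expanding the squares
    gives [|Q z - y|^2 = |c - S z|^2 + (|y|^2 - |c|^2)], so the two objectives
    agree at every [w], and [z = S^-1 c] shows [|c| <= |y|].  The minimum is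
    attained by compactness when [epsilon + lambda > 0], because the objective
    is then coercive; when [epsilon = lambda = 0] it is [s], attained where
    [R^T w = c].  The existence of [S] comes from the spectral theorem over the
    complexification of [K], by real polynomial interpolation at the
    eigenvalues. *)

(** * Symmetric matrices and the Euclidean inner product *)

Lemma symmetricmxE (K : realType) k (A : 'M[K]_k) :
  (A \is symmetricmx) = (A^T == A).
Proof. by rewrite is_hermitianmxE expr0 scale1r map_mx_id // eq_sym. Qed.

Lemma dotcVE (K : realType) d (u v : 'cV[K]_d) :
  dotcV u v = \sum_i u i 0 * v i 0.
Proof. by rewrite /dotcV !mxE; apply: eq_bigr => i _; rewrite mxE. Qed.

Lemma dotcVC (K : realType) d (u v : 'cV[K]_d) : dotcV u v = dotcV v u.
Proof. by rewrite !dotcVE; apply: eq_bigr => i _; rewrite mulrC. Qed.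

Lemma dotcVBl (K : realType) d (u v w : 'cV[K]_d) :
  dotcV (u - v) w = dotcV u w - dotcV v w.
Proof. by rewrite /dotcV linearB mulmxBl !mxE. Qed.

Lemma dotcVBr (K : realType) d (u v w : 'cV[K]_d) :
  dotcV w (u - v) = dotcV w u - dotcV w v.
Proof. by rewrite /dotcV mulmxBr !mxE. Qed.

Lemma dotcV_mull (K : realType) m d (B : 'M[K]_(m, d)) u v :
  dotcV (B *m u) v = dotcV u (B^T *m v).
Proof. by rewrite /dotcV trmx_mul mulmxA. Qed.

Lemma dotcV00 (K : realType) d : dotcV (0 : 'cV[K]_d) 0 = 0.
Proof. by rewrite /dotcV mulmx0 mxE. Qed.

Lemma dotcV_ge0 (K : realType) d (u : 'cV[K]_d) : 0 <= dotcV u u.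
Proof. by rewrite dotcVE; apply: sumr_ge0 => i _; rewrite -expr2 sqr_ge0. Qed.

Lemma dotcV_gt0 (K : realType) d (u : 'cV[K]_d) : u != 0 -> 0 < dotcV u u.
Proof.
move=> u0; rewrite lt0r dotcV_ge0 andbT; apply: contra u0.
rewrite dotcVE psumr_eq0 => [/allP u0|i _]; last by rewrite -expr2 sqr_ge0.
apply/eqP/colP => i; rewrite mxE; apply/eqP.
by rewrite -sqrf_eq0 expr2; apply: u0; rewrite mem_index_enum.
Qed.

Lemma norm2E (K : realType) d (v : 'cV[K]_d) : norm2 v = Num.sqrt (dotcV v v).
Proof. by rewrite /norm2 dotcVE; under eq_bigr do rewrite expr2. Qed.

(** * Polynomials in a symmetric matrix, and positive definite square roots *)

Lemma trmx_horner_mx (K : realType) k (A : 'M[K]_k.+1) (p : {poly K}) :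
  (horner_mx A p)^T = horner_mx A^T p.
Proof.
elim/poly_ind: p => [|p c IH]; first by rewrite !rmorph0 trmx0.
rewrite !rmorphD !rmorphM /= !horner_mx_X !horner_mx_C linearD /= trmx_mul.
by rewrite tr_scalar_mx IH; congr (_ + _); apply: comm_mx_horner.
Qed.

(** Newton's scheme: each new node is corrected by a multiple of the polynomial vanishing at the
    earlier ones. Nodes may repeat, as eigenvalues listed with multiplicity do. *)
Lemma interpolation (K : fieldType) (f : K -> K) (s : seq K) :
  exists p : {poly K}, {in s, forall x, p.[x] = f x}.
Proof.
elim: s => [|a s [p Hp]]; first by exists 0.
have [sa|sa] := boolP (a \in s).
  by exists p => x; rewrite inE => /predU1P [->|]; apply: Hp.
pose q := \prod_(x <- s) ('X - x%:P).
have qa : q.[a] != 0 by rewrite -/(root q a) root_prod_XsubC.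
exists (p + ((f a - p.[a]) / q.[a]) *: q) => x.
rewrite inE !hornerE => /predU1P [->|xs].
  by rewrite divfK // addrC subrK.
have /rootP -> : root q x by rewrite root_prod_XsubC.
by rewrite mulr0 addr0 Hp.
Qed.

(** This is the form in which the spectral theorem is used: a polynomial identity in [A] may be
    checked on real eigenvalues alone. Over [K[i]] the matrix is Hermitian, hence unitarily
    diagonalizable with real spectrum. *)
Lemma symmetric_annihilator (K : realType) k (A : 'M[K]_k.+1) :
  A \is symmetricmx ->
  exists e : 'I_k.+1 -> K, (forall i, eigenvalue A (e i)) /\
    forall p : {poly K}, (forall i, p.[e i] = 0) -> horner_mx A p = 0.
Proof.
move=> symA; pose C : numClosedFieldType := K[i].
pose toC : {rmorphism K -> C} := real_complex K.
pose A' := map_mx toC A.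
have hermA : A' \is hermsymmx.
  apply: realsym_hermsym.
    rewrite is_hermitianmxE expr0 scale1r map_mx_id //.
    by move: symA; rewrite symmetricmxE => /eqP sA; rewrite map_trmx sA.
  apply/mxOverP => i j; by rewrite mxE; apply/complex_realP; exists (A i j).
have /orthomx_spectralP := hermitian_normalmx hermA.
have /mxOverP dR := hermitian_spectral_diag_real hermA.
move: (spectralmx A') (spectral_diag A') dR (spectral_unit A').
move=> U d dR Uu eqA; pose e i := complex.Re (d 0 i).
have toCe i : toC (e i) = d 0 i.
  exact: RRe_real.
exists e; split=> [i|p pe].
  (* Being a root of the characteristic polynomial descends from [K[i]] to [K]; over [K[i]], row [i]
     of [U] is an eigenvector. *)
  rewrite eigenvalue_root_char -(fmorph_root toC) map_char_poly -/A'.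
  rewrite -eigenvalue_root_char toCe; apply/eigenvalueP; exists (row i U).
    rewrite eqA -!row_mul !mulmxA mulmxV // mul1mx row_mul row_diag_mx.
    by rewrite -scalemxAl -rowE.
  apply/eqP => /(congr1 (mulmx^~ (invmx U))).
  rewrite -row_mul mulmxV // mul0mx => /rowP /(_ i) /eqP.
  by rewrite !mxE eqxx oner_eq0.
(* Conjugation by [U] turns [p] of the matrix into the diagonal matrix of the values [p.[e i]]. *)
apply/eqP; rewrite -(map_mx_eq0 toC) map_horner_mx -/A' eqA.
rewrite horner_mx_uconjC // horner_mx_diag.
suff -> : map_mx (horner (map_poly toC p)) d = 0.
  by rewrite linear0 mulmx0 mul0mx.
by apply/rowP => i; rewrite !mxE -toCe horner_map pe rmorph0.
Qed.

(** On an eigenvector the quadratic form equals [a] times the squared norm. *)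
Lemma posdefmx_eigenvalue (K : realType) k (A : 'M[K]_k) a :
  posdefmx A -> eigenvalue A a -> 0 < a.
Proof.
move=> [symA posA] /eigenvalueP [v vA v0].
have vT0 : v^T != 0 by rewrite trmx_eq0.
have AT : A^T = A by apply/eqP; rewrite -symmetricmxE.
have := posA _ vT0; rewrite -{1}AT -trmx_mul vA linearZ /= /dotcV -scalemxAr.
by rewrite mxE pmulr_lgt0 // -/(dotcV _ _) dotcV_gt0.
Qed.

(* The square root is T^2 with T = q(A), where the real polynomial q takes the
   value a^(1/4) at each eigenvalue a of A. *)
Lemma posdefmx_sqrt (K : realType) k (A : 'M[K]_k) :
  posdefmx A -> exists S, posdefmx S /\ S *m S = A.
Proof.
case: k A => [|k] A pA.
  by exists A; split=> //; apply/matrixP => -[]-[].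
have [symA posA] := pA.
have AT : A^T = A by apply/eqP; rewrite -symmetricmxE.
have [e [eA annA]] := symmetric_annihilator symA.
have [q qE] := interpolation (fun x => Num.sqrt (Num.sqrt x)) (codom e).
pose T := horner_mx A q.
have T4 : (T *m T) *m (T *m T) = A.
  apply/eqP; rewrite -subr_eq0; apply/eqP.
  rewrite -[RHS](annA (q * q * (q * q) - 'X)) => [|i].
    by rewrite rmorphB !rmorphM /= horner_mx_X.
  rewrite !(hornerD, hornerN, hornerX, hornerM) qE ?codom_f //.
  have e0 := ltW (posdefmx_eigenvalue pA (eA i)).
  by rewrite -!expr2 !sqr_sqrtr ?sqrtr_ge0 ?subrr.
have TT : T^T = T by rewrite trmx_horner_mx AT.
exists (T *m T); split=> //; split.
  by rewrite symmetricmxE trmx_mul TT.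
(* Fourth roots pay off here: the form of [T *m T] at [x] is the squared norm of [T *m x], and
   [T *m x = 0] would force [A *m x = 0]. *)
move=> x x0; rewrite -mulmxA -{1}TT -dotcV_mull.
apply: dotcV_gt0; apply: contraTneq (posA x x0) => Tx0.
by rewrite -T4 -!mulmxA Tx0 !mulmx0 /dotcV mulmx0 mxE ltxx.
Qed.

Lemma sqrtmxP (K : realType) k (A : 'M[K]_k) :
  posdefmx A -> posdefmx (sqrtmx A) /\ sqrtmx A *m sqrtmx A = A.
Proof.
by move=> /posdefmx_sqrt [S SA]; rewrite /sqrtmx; case: xgetP => // /(_ S) [].
Qed.

Lemma posdefmx_unit (K : realType) k (A : 'M[K]_k) :
  posdefmx A -> A \in unitmx.
Proof.
move=> [_ posA]; rewrite -unitmx_tr -row_free_unit -kermx_eq0.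
apply/negPn/negP => /rowV0Pn [v /sub_kermxP vA v0].
have := posA v^T; rewrite trmx_eq0 => /(_ v0).
by rewrite -[A]trmxK -trmx_mul vA trmx0 /dotcV mulmx0 mxE ltxx.
Qed.

(** The form at [x] is the squared norm of [Q *m x], and full column rank makes [Q] injective. *)
Lemma posdefmx_gram (K : realType) m k (Q : 'M[K]_(m, k)) :
  \rank Q = k -> posdefmx (Q^T *m Q).
Proof.
move=> rQ; split=> [|x x0]; first by rewrite symmetricmxE trmx_mul trmxK.
rewrite -mulmxA -dotcV_mull dotcV_gt0 //.
have fQ : row_free Q^T by rewrite /row_free mxrank_tr rQ.
apply: contra x0 => /eqP Qx; rewrite -trmx_eq0; apply/eqP.
by apply: (row_free_inj fQ); rewrite -trmx_mul Qx mul0mx trmx0.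
Qed.

(** * Norm bounds, continuity, and attainment of the minimum *)

Lemma norm2_ge0 (K : realType) d (v : 'cV[K]_d) : 0 <= norm2 v.
Proof. exact: sqrtr_ge0. Qed.

Lemma norm1_ge0 (K : realType) d (v : 'cV[K]_d) : 0 <= norm1 v.
Proof. exact: sumr_ge0. Qed.

Lemma ler_coord_norm2 (K : realType) d (v : 'cV[K]_d) i :
  `|v i 0| <= norm2 v.
Proof.
rewrite -sqrtr_sqr ler_wsqrtr // (bigD1 i) //= lerDl.
by apply: sumr_ge0 => j _; rewrite sqr_ge0.
Qed.

Lemma ler_coord_norm1 (K : realType) d (v : 'cV[K]_d) i :
  `|v i 0| <= norm1 v.
Proof. by rewrite /norm1 (bigD1 i) //= lerDl sumr_ge0. Qed.

Lemma norm20 (K : realType) d : norm2 (0 : 'cV[K]_d) = 0.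
Proof.
by rewrite /norm2 big1 ?sqrtr0 // => i _; rewrite mxE expr0n.
Qed.

Lemma norm10 (K : realType) d : norm1 (0 : 'cV[K]_d) = 0.
Proof. by rewrite /norm1 big1 // => i _; rewrite mxE normr0. Qed.

Local Open Scope classical_set_scope.

Lemma continuous_sum (K : realType) (T : topologicalType) (I : Type)
    (r : seq I) (F : I -> T -> K) :
  (forall i, continuous (F i)) -> continuous (fun x => \sum_(i <- r) F i x).
Proof. by move=> cF; apply: continuous_big => //; exact: add_continuous. Qed.

Lemma continuous_norm2 (K : realType) (T : topologicalType) d
    (g : T -> 'cV[K]_d) :
  (forall i, continuous (fun x => g x i 0)) ->
  continuous (fun x => norm2 (g x)).
Proof.
move=> cg x.
apply: (@continuous_comp _ _ _ (fun x => \sum_i g x i 0 ^+ 2) Num.sqrt);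
  last exact: sqrt_continuous.
apply: continuous_sum => i {}x; under eq_fun do rewrite expr2.
by apply: cvgM; exact: cg.
Qed.

Lemma continuous_norm1 (K : realType) (T : topologicalType) d
    (g : T -> 'cV[K]_d) :
  (forall i, continuous (fun x => g x i 0)) ->
  continuous (fun x => norm1 (g x)).
Proof.
by move=> cg; apply: continuous_sum => i x; apply: cvg_norm; exact: cg.
Qed.

Section Objective.
Variables (K : realType) (n d : nat) (B : 'M[K]_(d, n)) (b : 'cV[K]_d).
Variables (epsilon lambda : K).

Let obj (w : 'cV[K]_n) : K :=
  norm2 (B *m w - b) + epsilon * norm2 w + lambda * norm1 w.

(** Transposed to row vectors, the setting of the compactness and extreme value results applied
    below. *)
Lemma continuous_objective : continuous (fun v : 'rV[K]_n => obj v^T).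
Proof.
have ctr i : continuous (fun v : 'rV[K]_n => v^T i 0).
  by under eq_fun do rewrite mxE; exact: coord_continuous.
have cM (a : K) (f : 'rV[K]_n -> K) :
    continuous f -> continuous (fun v => a * f v).
  by move=> cf v; apply: continuousM (cf v); exact: cst_continuous.
have cres : continuous (fun v : 'rV[K]_n => norm2 (B *m v^T - b)).
  apply: continuous_norm2 => i; under eq_fun do rewrite !mxE.
  have cBv : continuous (fun v : 'rV[K]_n => \sum_j B i j * v^T j 0).
    by apply: continuous_sum => j; exact: cM.
  by move=> v; apply: continuousB (cBv v) _; exact: cst_continuous.
have cn2 : continuous (fun v : 'rV[K]_n => epsilon * norm2 v^T).
  by apply/cM/continuous_norm2.
have cn1 : continuous (fun v : 'rV[K]_n => lambda * norm1 v^T).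
  by apply/cM/continuous_norm1.
by move=> v; exact: continuousD (continuousD (cres v) (cn2 v)) (cn1 v).
Qed.

Lemma objective_is_min : 0 <= epsilon -> 0 <= lambda ->
  0 < epsilon + lambda -> exists v, is_min obj v.
Proof.
(* [M] is chosen so that a vector with some coordinate beyond [M] in absolute value has objective
   above [obj 0], by [coercive]; a minimum over the box, which contains 0, is then global. *)
move=> e0 l0 el0; pose M := obj 0 / (epsilon + lambda).
have obj0 : 0 <= obj 0.
  by rewrite /obj norm20 norm10 !mulr0 !addr0 norm2_ge0.
have M0 : 0 <= M by rewrite divr_ge0 // ltW.
have coercive (w : 'cV[K]_n) i : (epsilon + lambda) * `|w i 0| <= obj w.
  rewrite mulrDl /obj -addrA; apply: ler_wpDl; first exact: norm2_ge0.
  by apply: lerD; apply: ler_wpM2l;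
    rewrite // ?ler_coord_norm2 ?ler_coord_norm1.
pose box := [set v : 'rV[K]_n | forall i, `[- M, M]%classic (v 0 i)].
have box0 : box 0 by move=> i; rewrite /= mxE in_itv /= oppr_le0 M0.
have cbox : compact box.
  by apply: (@rV_compact K n (fun=> `[- M, M]%classic)) => i; exact: segment_compact.
have [||v vbox vmin] := @EVT_min_rV _ _ (fun v => obj v^T) box _ cbox.
- by exists 0.
- exact/continuous_subspaceT/continuous_objective.
exists (obj v^T); split; first by exists v^T.
move=> w; have [wbox|wbox] := pselect (box w^T).
  by rewrite -[w in leRHS]trmxK; apply: vmin; rewrite inE.
have := vmin 0; rewrite inE trmx0 => /(_ box0) /le_trans; apply.
have [i /negP wi] : exists i, ~ (- M <= w i 0 <= M).
  apply: contrapT => nex; apply: wbox => i; rewrite /= mxE in_itv /=.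
  by apply: contrapT => wi; apply: nex; exists i.
move: wi; rewrite -ler_norml -ltNge ltr_pdivrMr // mulrC => /ltW /le_trans.
by apply; exact: coercive.
Qed.

End Objective.

(** * Equality of the two objectives, and the main result *)

Lemma norm2_col_mx_const (K : realType) d (u : 'cV[K]_d) (a : K) :
  norm2 (col_mx u (const_mx a : 'cV[K]_1)) = Num.sqrt (dotcV u u + a ^+ 2).
Proof.
rewrite norm2E /dotcV tr_col_mx mul_row_col mxE.
by congr (Num.sqrt (_ + _)); rewrite !mxE big_ord1 !mxE expr2.
Qed.

(** The hypotheses on [S] and [c] match the quadratic and the cross terms of the two expansions, so
    only the constants differ. *)
Lemma gram_sqrt_residual (K : realType) m k (Q : 'M[K]_(m, k)) (S : 'M[K]_k)
    (y : 'cV[K]_m) (c z : 'cV[K]_k) :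
  S^T = S -> S *m S = Q^T *m Q -> S *m c = Q^T *m y ->
  dotcV (Q *m z - y) (Q *m z - y) =
  dotcV (c - S *m z) (c - S *m z) + (dotcV y y - dotcV c c).
Proof.
move=> ST SS Sc.
have QQ : dotcV (Q *m z) (Q *m z) = dotcV (S *m z) (S *m z).
  by rewrite !dotcV_mull ST !mulmxA SS.
have Qy : dotcV (Q *m z) y = dotcV (S *m z) c.
  by rewrite !dotcV_mull ST Sc.
rewrite !dotcVBl !dotcVBr [dotcV y (Q *m z)]dotcVC [dotcV c (S *m z)]dotcVC.
by rewrite QQ Qy; ring.
Qed.

Theorem mainTheorem1 (K : realType) (n m k : nat)
    (P : 'M[K]_(n, k)) (Q : 'M[K]_(m, k)) (y : 'cV[K]_m) (lambda epsilon : K)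
    (hP : \rank P = k) (hQ : \rank Q = k) (hk : (k < minn m n)%N)
    (hy : y != 0) (hlambda : 0 <= lambda) (hepsilon : 0 <= epsilon) :
  let c : 'cV[K]_k := invmx (sqrtmx (Q^T *m Q)) *m Q^T *m y in
  let s : K := Num.sqrt (dotcV y y - dotcV c c) in
  let R : 'M[K]_(n, k) := P *m sqrtmx (Q^T *m Q) in
  dotcV c c <= dotcV y y /\
  exists v : K,
    is_min (fun w : 'cV[K]_n =>
      norm2 ((P *m Q^T)^T *m w - y) + epsilon * norm2 w + lambda * norm1 w) v
    /\
    is_min (fun w : 'cV[K]_n =>
      norm2 (col_mx (c - R^T *m w) (const_mx s : 'cV[K]_1))
        + epsilon * norm2 w + lambda * norm1 w) v.
Proof.
have [posS SS] := sqrtmxP (posdefmx_gram hQ).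
move: (sqrtmx _) posS SS => S posS SS c s R.
have ST : S^T = S by apply/eqP; rewrite -symmetricmxE; case: posS.
have uS := posdefmx_unit posS.
have Sc : S *m c = Q^T *m y by rewrite /c -mulmxA mulKVmx.
have residual z := gram_sqrt_residual z ST SS Sc.
have cy : dotcV c c <= dotcV y y.
  rewrite -subr_ge0; have := residual (invmx S *m c).
  rewrite mulKVmx // subrr dotcV00 add0r => <-; exact: dotcV_ge0.
have RTE w : R^T *m w = S *m (P^T *m w) by rewrite trmx_mul ST -mulmxA.
have colE w : norm2 (col_mx (c - R^T *m w) (const_mx s : 'cV[K]_1)) =
    norm2 ((P *m Q^T)^T *m w - y).
  rewrite norm2_col_mx_const norm2E [(P *m Q^T)^T]trmx_mul trmxK -mulmxA.
  by rewrite residual RTE sqr_sqrtr // subr_ge0.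
split=> //.
suff [v vmin] : exists v, is_min (fun w : 'cV[K]_n =>
    norm2 ((P *m Q^T)^T *m w - y) + epsilon * norm2 w + lambda * norm1 w) v.
  by exists v; split=> //; under eq_fun do rewrite colE.
have [el0|] := ltP 0 (epsilon + lambda); first exact: objective_is_min.
(* Nonnegative weights with nonpositive sum both vanish. The objective may then fail to be coercive,
   so a minimizer is built explicitly. *)
rewrite le_eqVlt ltNge addr_ge0 // orbF paddr_eq0 // => /andP[/eqP-> /eqP->].
exists s; split=> [|w]; last first.
  rewrite !mul0r !addr0 -colE norm2_col_mx_const.
  rewrite -[leLHS]ger0_norm ?sqrtr_ge0 // -sqrtr_sqr ler_wsqrtr //.
  by rewrite lerDr dotcV_ge0.
have [w Pw] : exists w, P^T *m w = invmx S *m c.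
  (* Full column rank of [P] gives [P^T] a right inverse [B]. *)
  have /row_freeP [B PB] : row_free P^T by rewrite /row_free mxrank_tr hP.
  by exists (B *m (invmx S *m c)); rewrite mulmxA PB mul1mx.
exists w; rewrite !mul0r !addr0 -colE norm2_col_mx_const RTE Pw mulKVmx //.
by rewrite subrr dotcV00 add0r sqrtr_sqr ger0_norm ?sqrtr_ge0.
Qed.
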